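(* (In ZF+DC+PB.) Let $X$ be a Polish space and let $\mathcal{KD}$ be the monoid of set operators on $X$ generated by $k$ (closure), $c$ (complement) and $d$ (points of second category). Then the cardinality of $\mathcal{KD}$ is $\leq 18$. Moreover, if $X=\mathbb{R}$ with the usual topology, then there exists a set $A\subseteq\mathbb{R}$ for which $\#\{oA : o\in\mathcal{KD}\}=18$.
   Context: The base theory is ZF together with DC (the Axiom of Dependent Choice) and PB, the axiom ''every subset of every Polish space has the Baire property''; the full Axiom of Choice is not assumed. A Polish space is a separable completely metrizable topological space. A set $A\subseteq X$ has the Baire property if there exists an open set $U\subseteq X$ for which the symmetric difference $A\Delta U=(A\setminus U)\cup(U\setminus A)$ is meager. A set operator on $X$ is a map from the power set of $X$ to itself; operators are multiplied by composition, and $oA$ denotes the value of $o$ at $A\subseteq X$. For $A\subseteq X$: $kA$ is the topological closure of $A$; $cA=X\setminus A$; and $dA$ is the set of all points of second category for $A$, i.e. $dA=\{p\in X : \text{for every open neighborhood } U \text{ of } p,\ U\cap A \text{ is nonmeager in } X\}$. $\mathcal{KD}$ is the monoid (under composition, containing the identity operator) of set operators on $X$ generated by $k$, $c$ and $d$. *)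

(* Defs.v *)
From Stdlib Require Import Reals Ensembles Finite_sets Image.

Open Scope R_scope.

(* Nothing below uses a form of choice: the points of a MathComp-Analysis
   topological space carry a choice operator, which already refutes PB when the
   space is R, so topological spaces are defined here over bare types. *)

Arguments In {U}.
Arguments Included {U}.
Arguments Inhabited {U}.
Arguments Full_set {U}.
Arguments Complement {U}.
Arguments Setminus {U}.
Arguments Union {U}.
Arguments Intersection {U}.
Arguments cardinal {U}.
Arguments Im {U V}.

(* The empty set is open by [open_bigunion] applied to the empty family. *)
Record TopologicalSpace : Type := {
  point :> Type;
  is_open : Ensemble (Ensemble point);
  open_full : is_open Full_set;
  open_intersection : forall U V,
    is_open U -> is_open V -> is_open (Intersection U V);
  open_bigunion : forall F : Ensemble (Ensemble point),
    (forall U, F U -> is_open U) -> is_open (fun x => exists U, F U /\ U x)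
}.

Arguments is_open {t}.

Definition closure {X : TopologicalSpace} (A : Ensemble X) : Ensemble X :=
  fun p => forall U, is_open U -> In U p -> Inhabited (Intersection U A).

Definition nowhere_dense {X : TopologicalSpace} (N : Ensemble X) : Prop :=
  forall U, is_open U -> Included U (closure N) -> ~ Inhabited U.

Definition meager {X : TopologicalSpace} (M : Ensemble X) : Prop :=
  exists F : nat -> Ensemble X,
    (forall n, nowhere_dense (F n)) /\
    (forall x, In M x <-> exists n, In (F n) x).

Definition symmetric_difference {X : Type} (A B : Ensemble X) : Ensemble X :=
  Union (Setminus A B) (Setminus B A).

Definition Baire_property {X : TopologicalSpace} (A : Ensemble X) : Prop :=
  exists U, is_open U /\ meager (symmetric_difference A U).

Definition is_metric {X : Type} (dist : X -> X -> R) : Prop :=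
  (forall x y, 0 <= dist x y) /\
  (forall x y, dist x y = 0 <-> x = y) /\
  (forall x y, dist x y = dist y x) /\
  (forall x y z, dist x z <= dist x y + dist y z).

Definition is_complete {X : Type} (dist : X -> X -> R) : Prop :=
  forall u : nat -> X,
    (forall e, 0 < e -> exists N, forall m n,
       (N <= m)%nat -> (N <= n)%nat -> dist (u m) (u n) < e) ->
    exists l, forall e, 0 < e -> exists N, forall n,
       (N <= n)%nat -> dist (u n) l < e.

Definition induces_topology {X : TopologicalSpace} (dist : X -> X -> R) : Prop :=
  forall U : Ensemble X,
    is_open U <->
    forall x, In U x -> exists e, 0 < e /\ forall y, dist x y < e -> In U y.

Definition countable {X : Type} (D : Ensemble X) : Prop :=
  exists f : X -> nat, forall x y, In D x -> In D y -> f x = f y -> x = y.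

Definition separable (X : TopologicalSpace) : Prop :=
  exists D : Ensemble X, countable D /\ forall x, In (closure D) x.

Definition completely_metrizable (X : TopologicalSpace) : Prop :=
  exists dist : X -> X -> R,
    is_metric dist /\ is_complete dist /\ induces_topology dist.

(* The empty space is Polish under this definition. *)
Definition Polish (X : TopologicalSpace) : Prop :=
  separable X /\ completely_metrizable X.

Definition DC : Prop :=
  forall (T : Type) (r : T -> T -> Prop),
    inhabited T -> (forall x, exists y, r x y) ->
    exists u : nat -> T, forall n, r (u n) (u (S n)).

Definition PB : Prop :=
  forall X : TopologicalSpace, Polish X ->
  forall A : Ensemble X, Baire_property A.

Definition set_operator (X : Type) : Type := Ensemble X -> Ensemble X.

Definition second_category_points {X : TopologicalSpace} : set_operator X :=
  fun A p => forall U, is_open U -> In U p -> ~ meager (Intersection U A).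

Inductive KD (X : TopologicalSpace) : Ensemble (set_operator X) :=
| KD_one : KD X (fun A => A)
| KD_k : KD X closure
| KD_c : KD X Complement
| KD_d : KD X second_category_points
| KD_mul o1 o2 : KD X o1 -> KD X o2 -> KD X (fun A => o1 (o2 A)).

Definition card_le {T : Type} (E : Ensemble T) (n : nat) : Prop :=
  exists m, cardinal E m /\ (m <= n)%nat.

(* [restrict_BP o] is [o] restricted to the sets with the Baire property.
   These form an algebra stable under k, c and d (closed and open sets have
   the Baire property), so the image of [KD X] under [restrict_BP] is the
   monoid generated by the restrictions of k, c and d. *)
Definition restrict_BP {X : TopologicalSpace} (o : set_operator X) :
    {A : Ensemble X | Baire_property A} -> Ensemble X :=
  fun A => o (proj1_sig A).

Lemma R_open_bigunion (F : Ensemble (Ensemble R)) :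
  (forall U, F U -> open_set U) -> open_set (fun x => exists U, F U /\ U x).
Proof.
  intros HF x [U [FU Ux]].
  destruct (HF U FU x Ux) as [delta Hdelta].
  exists delta; intros y Hy; exists U; split; [exact FU | exact (Hdelta y Hy)].
Qed.

Lemma R_open_intersection (U V : Ensemble R) :
  open_set U -> open_set V -> open_set (Intersection U V).
Proof.
  intros HU HV x [z Uz Vz].
  destruct (open_set_P3 U V HU HV z (conj Uz Vz)) as [delta Hdelta].
  exists delta; intros y Hy; destruct (Hdelta y Hy); split; assumption.
Qed.

Lemma R_open_full : open_set (@Full_set R).
Proof.
  intros x _; exists (mkposreal 1 Rlt_0_1); intros y _; constructor.
Qed.

Definition R_top : TopologicalSpace := {|
  point := R;
  is_open := open_set;
  open_full := R_open_full;
  open_intersection := R_open_intersection;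
  open_bigunion := R_open_bigunion
|}.

(* Main.v *)
Require Import Defs.
From Stdlib Require Import Reals Ensembles Finite_sets Image.
From Stdlib Require Import Lra Lia List.
From Stdlib Require Import Classical FunctionalExtensionality PropExtensionality.
Import ListNotations.

(** Write [k], [c], [d] for closure, complement and points of second category.

    Upper bound.  If [A] has the Baire property, then [A] differs by a meager
    set from an open set [U], and [d] ignores meager differences, so
    [d A = d U].  In a Baire space a nonempty open set is not meager, which
    gives [d U = k U] for open [U].  A closed set differs from its interior by
    its nowhere dense boundary, so [d] of a closed set is the closure of its
    interior.  Thus [d (k Y) = k c k c k Y] and [d (c k Y) = k c k Y], while
    [d A] is the closure of an open set and [d c A = k c d A].  Together with
    [k k = k], [c c = 1] and Kuratowski's [k c k c k c k = k c k], these
    identities bring every word in [k], [c], [d] to one of eighteen: the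
    fourteen words of Kuratowski and [d], [c d], [k c d], [c k c d].  The list
    [eighteen] holds them; [KD_mul_eighteen] says that it is stable under
    multiplication on the left, as far as sets with the Baire property are
    concerned.  Polish spaces enter only through the Baire category theorem
    [completely_metrizable_Baire], which dependent choice proves.

    Lower bound.  In the line take the rationals below 0, the point 1, the
    interval from 2 to 4 without 3, and the irrationals above 4.  It differs
    from the ray above 2 by a set of rationals only, so [d] sees just that
    ray.  Its eighteen images are told apart by which of the six points -1,
    3, 1, 2, 5, 1/2 they contain.

    Both assertions are proved for sets with the Baire property; under [PB]
    these are all sets of a Polish space, so [PB] is used only to read the
    same equalities as equalities of operators on the whole power set. *)

(** * Sets, lists and cardinals *)

Lemma set_ext {T : Type} (A B : Ensemble T) : (forall x, A x <-> B x) -> A = B.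
Proof.
  intros H; apply functional_extensionality; intros x.
  apply propositional_extensionality; apply H.
Qed.

Lemma Complement_Complement {T : Type} (A : Ensemble T) :
  Complement (Complement A) = A.
Proof.
  apply set_ext; intros x; split; [apply NNPP | intros Ax nAx; exact (nAx Ax)].
Qed.

(** The list may repeat elements and contain strangers to [E], so that the
    eighteen operators need not be distinct on a given space. *)
Lemma card_le_of_list {T : Type} (l : list T) (E : Ensemble T) :
  (forall x, E x -> List.In x l) -> card_le E (length l).
Proof.
  revert E; induction l as [|a l IH]; intros E HE.
  - exists 0%nat; split; [|apply le_n].
    replace E with (@Empty_set T); [constructor|].
    apply set_ext; intros x; split; [intros []|intros Ex; destruct (HE x Ex)].
  - destruct (classic (E a)) as [Ea|nEa].
    + destruct (IH (fun x => E x /\ x <> a)) as [m [Hm lem]].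
      { intros x [Ex nx]; destruct (HE x Ex) as [e|?];
          [destruct nx; symmetry; exact e | assumption]. }
      exists (S m); split; [|simpl; lia].
      replace E with (Ensembles.Add T (fun x => E x /\ x <> a) a);
        [constructor; [exact Hm | intros [_ n]; exact (n eq_refl)]|].
      apply set_ext; intros x; split.
      * intros [y [Ey _]|y []]; assumption.
      * intros Ex; destruct (classic (x = a)) as [->|nx];
          [right; constructor | left; split; assumption].
    + destruct (IH E) as [m [Hm lem]]; [|exists m; split; [exact Hm|simpl; lia]].
      intros x Ex; destruct (HE x Ex) as [<-|?]; [contradiction|assumption].
Qed.

Lemma cardinal_of_NoDup {T : Type} (l : list T) :
  NoDup l -> cardinal (fun x => List.In x l) (length l).
Proof.
  induction 1 as [|a l nal _ IH].
  - replace (fun x : T => List.In x []) with (@Empty_set T); [constructor|].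
    apply set_ext; intros x; split; intros [].
  - replace (fun x => List.In x (a :: l)) with (Ensembles.Add T (fun x => List.In x l) a);
      [constructor; assumption|].
    apply set_ext; intros x; split.
    + intros [y ly|y []]; [right; exact ly | left; reflexivity].
    + intros [<-|lx]; [right; constructor | left; exact lx].
Qed.

(** Sets cannot be compared by computation, boolean vectors can: [P]
    ties each entry to a vector that it determines. *)
Lemma NoDup_of_Forall2 {T V : Type} (P : T -> V -> Prop) (l : list T) (vs : list V) :
  (forall x v v', P x v -> P x v' -> v = v') ->
  Forall2 P l vs -> NoDup vs -> NoDup l.
Proof.
  intros HP; induction 1 as [|x v l vs Pxv Pl IH]; intros Hvs; [constructor|].
  inversion Hvs as [|? ? nv Hvs']; subst; constructor; [|exact (IH Hvs')].
  intros lx; apply nv; clear - HP Pxv Pl lx.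
  induction Pl as [|y w l vs Pyw _ IH]; [destruct lx|].
  destruct lx as [->|lx];
    [left; exact (HP x w v Pyw Pxv) | right; exact (IH lx)].
Qed.

Lemma Forall2_truth_values {T : Type} (A : Ensemble T) (pts : list T) (v v' : list bool) :
  Forall2 (fun p b => A p <-> b = true) pts v ->
  Forall2 (fun p b => A p <-> b = true) pts v' -> v = v'.
Proof.
  intros H; revert v'; induction H as [|p b pts v Hb _ IH];
    intros v' H'; inversion H' as [|? b' ? w Hb' Hw]; subst; [reflexivity|].
  rewrite (IH w Hw); f_equal; destruct b, b'; intuition congruence.
Qed.

(** * Closure and interior *)

Lemma subset_closure {X : TopologicalSpace} (A : Ensemble X) x : A x -> closure A x.
Proof. intros Ax U _ Ux; exists x; split; assumption. Qed.

Lemma closure_mono {X : TopologicalSpace} (A B : Ensemble X) :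
  (forall x, A x -> B x) -> forall x, closure A x -> closure B x.
Proof.
  intros AB x kx U oU Ux; destruct (kx U oU Ux) as [y [z Uz Az]].
  exists z; split; [exact Uz | exact (AB z Az)].
Qed.

Lemma closure_closure {X : TopologicalSpace} (A : Ensemble X) :
  closure (closure A) = closure A.
Proof.
  apply set_ext; intros x; split; [|apply subset_closure].
  intros kx U oU Ux; destruct (kx U oU Ux) as [y [z Uz kz]]; exact (kz U oU Uz).
Qed.

Lemma open_disjoint_closure {X : TopologicalSpace} (U A : Ensemble X) :
  is_open U -> (forall x, U x -> ~ A x) -> forall x, U x -> ~ closure A x.
Proof.
  intros oU UA x Ux kx; destruct (kx U oU Ux) as [y [z Uz Az]]; exact (UA z Uz Az).
Qed.

Lemma open_Complement_closure {X : TopologicalSpace} (A : Ensemble X) :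
  is_open (Complement (closure A)).
Proof.
  replace (Complement (closure A)) with
    (fun x : X => exists U, (is_open U /\ forall y, U y -> ~ A y) /\ U x);
    [apply open_bigunion; intros U [oU _]; exact oU|].
  apply set_ext; intros x; split.
  - intros [U [[oU UA] Ux]]; exact (open_disjoint_closure U A oU UA x Ux).
  - intros nkx; apply NNPP; intros none; apply nkx; intros U oU Ux.
    apply NNPP; intros nUA; apply none; exists U; repeat split; try assumption.
    intros y Uy Ay; apply nUA; exists y; split; assumption.
Qed.

Lemma closure_Complement_open {X : TopologicalSpace} (U : Ensemble X) :
  is_open U -> closure (Complement U) = Complement U.
Proof.
  intros oU; apply set_ext; intros x; split; [|apply subset_closure].
  intros kx Ux; revert kx; apply (open_disjoint_closure U); try assumption.
  intros y Uy nUy; exact (nUy Uy).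
Qed.

Lemma open_subset_interior {X : TopologicalSpace} (U A : Ensemble X) :
  is_open U -> (forall x, U x -> A x) ->
  forall x, U x -> Complement (closure (Complement A)) x.
Proof.
  intros oU UA; apply open_disjoint_closure; [exact oU|].
  intros x Ux nAx; exact (nAx (UA x Ux)).
Qed.

Lemma interior_subset {X : TopologicalSpace} (A : Ensemble X) x :
  Complement (closure (Complement A)) x -> A x.
Proof.
  intros Hx; apply NNPP; intros nAx; apply Hx; apply subset_closure; exact nAx.
Qed.

(** With [i = c k c] and [V] the open set [c k Y] this says [k i k V = k V]:
    an open [V] lies in the interior of its closure. *)
Lemma Kuratowski_identity {X : TopologicalSpace} (Y : Ensemble X) :
  closure (Complement (closure (Complement (closure (Complement (closure Y)))))) =
  closure (Complement (closure Y)).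
Proof.
  set (V := Complement (closure Y)).
  apply set_ext; intros x; split; intros Hx.
  - rewrite <- closure_closure; revert x Hx.
    apply closure_mono; intros x; apply interior_subset.
  - revert x Hx; apply closure_mono.
    apply open_subset_interior; [apply open_Complement_closure|].
    apply subset_closure.
Qed.

(** * Meager sets *)

Lemma meager_subset {X : TopologicalSpace} (M N : Ensemble X) :
  meager M -> (forall x, N x -> M x) -> meager N.
Proof.
  intros [F [HF HM]] NM; exists (fun n => Intersection (F n) N); split.
  - intros n U oU Uk; apply (HF n U oU); intros x Ux.
    generalize (Uk x Ux); apply closure_mono; intros y [z Fz _]; exact Fz.
  - intros x; split.
    + intros Nx; destruct (proj1 (HM x) (NM x Nx)) as [n Fx].
      exists n; split; assumption.
    + intros [n [z _ Nz]]; exact Nz.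
Qed.

Lemma meager_Union {X : TopologicalSpace} (M N : Ensemble X) :
  meager M -> meager N -> meager (Union M N).
Proof.
  intros [F [HF HM]] [G [HG HN]].
  exists (fun n => if Nat.even n then F (Nat.div2 n) else G (Nat.div2 n)); split.
  - intros n; destruct (Nat.even n); [apply HF | apply HG].
  - intros x; split.
    + intros [y My|y Ny].
      * destruct (proj1 (HM y) My) as [n Fn]; exists (2 * n)%nat.
        rewrite Nat.even_even, Nat.div2_double; exact Fn.
      * destruct (proj1 (HN y) Ny) as [n Gn]; exists (S (2 * n)).
        rewrite Nat.div2_succ_double.
        replace (Nat.even (S (2 * n))) with false; [exact Gn|].
        symmetry; rewrite <- Nat.add_1_r; apply Nat.even_odd.
    + intros [n Hn]; destruct (Nat.even n).
      * left; apply HM; exists (Nat.div2 n); exact Hn.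
      * right; apply HN; exists (Nat.div2 n); exact Hn.
Qed.

Lemma meager_nowhere_dense {X : TopologicalSpace} (N : Ensemble X) :
  nowhere_dense N -> meager N.
Proof.
  intros HN; exists (fun _ => N); split; [intros _; exact HN|].
  intros x; split; [intros Nx; exists 0%nat; exact Nx | intros [_ Nx]; exact Nx].
Qed.

Lemma meager_of_empty {X : TopologicalSpace} (N : Ensemble X) :
  (forall x, ~ N x) -> meager N.
Proof.
  intros HN; apply meager_nowhere_dense; intros U oU Uk [x Ux].
  destruct (Uk x Ux U oU Ux) as [y [z _ Nz]]; exact (HN z Nz).
Qed.

(** An open set inside the closure of the boundary lies in the closed set, hence
    in its interior, which is an open set that misses the boundary. *)
Lemma meager_boundary {X : TopologicalSpace} (Y : Ensemble X) :
  meager (symmetric_difference (closure Y)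
            (Complement (closure (Complement (closure Y))))).
Proof.
  set (C := closure Y); set (V := Complement (closure (Complement C))).
  apply meager_subset with (M := Setminus C V).
  - apply meager_nowhere_dense; intros W oW Wk [w Ww].
    assert (WC : forall x, W x -> C x).
    { intros x Wx; unfold C; rewrite <- closure_closure.
      generalize (Wk x Wx); apply closure_mono; intros y [Cy _]; exact Cy. }
    apply (open_disjoint_closure V (Setminus C V) (open_Complement_closure _)) with w;
      [intros x Vx [_ nVx]; exact (nVx Vx) | | exact (Wk w Ww)].
    exact (open_subset_interior W C oW WC w Ww).
  - intros x [y Hy|y [Vy nCy]]; [exact Hy|].
    destruct (nCy (interior_subset C y Vy)).
Qed.

(** * The Baire category theorem *)

Definition Baire_space (X : TopologicalSpace) : Prop :=
  forall U : Ensemble X, is_open U -> Inhabited U -> ~ meager U.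

(** The states of the construction for Baire's theorem.  Dependent choice does
    not prescribe the first term of the sequence that it gives, so a state
    carries everything to be remembered: its ball stays in [U] and already
    avoids the sets [F j] for [j] below the depth.  Any state can then be the
    first one. *)
Record avoiding_ball {X : Type} (dist : X -> X -> R) (U : Ensemble X)
    (F : nat -> Ensemble X) : Type := {
  depth : nat;
  center : X;
  radius : R;
  radius_pos : 0 < radius;
  ball_in : forall y, dist center y < radius -> U y;
  ball_avoids : forall j y, (j < depth)%nat -> dist center y < radius -> ~ F j y
}.

Arguments depth {X dist U F}.
Arguments center {X dist U F}.
Arguments radius {X dist U F}.

(** The last inequality puts the closed ball of [b'] inside the open ball of
    [b], so that a limit of centers stays in every ball. *)
Definition refines {X : Type} {dist : X -> X -> R} {U : Ensemble X}
    {F : nat -> Ensemble X} (b b' : avoiding_ball dist U F) : Prop :=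
  depth b' = S (depth b) /\ radius b' < / INR (S (depth b)) /\
  dist (center b) (center b') + radius b' < radius b.

Lemma is_open_ball {X : TopologicalSpace} (dist : X -> X -> R) (x : X) (e : R) :
  is_metric dist -> induces_topology dist -> is_open (fun y => dist x y < e).
Proof.
  intros [_ [_ [_ tri]]] Htop; apply Htop; intros y Hy; unfold Ensembles.In in Hy.
  exists (e - dist x y); split; [lra|].
  intros z Hz; unfold Ensembles.In; specialize (tri x y z); lra.
Qed.

Lemma refinement_exists {X : TopologicalSpace} (dist : X -> X -> R) (U : Ensemble X)
    (F : nat -> Ensemble X) (b : avoiding_ball dist U F) :
  is_metric dist -> induces_topology dist -> (forall n, nowhere_dense (F n)) ->
  exists b', refines b b'.
Proof.
  intros Hm Htop HF; destruct b as [n x e e0 bU bF].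
  pose proof Hm as [_ [Hz [_ tri]]].
  pose proof (is_open_ball dist x e Hm Htop) as oB.
  assert (Hy : exists y, dist x y < e /\ ~ closure (F n) y).
  { apply NNPP; intros none; apply (HF n _ oB).
    - intros y Hy; apply NNPP; intros nk; apply none; exists y; split; assumption.
    - exists x; unfold Ensembles.In; rewrite (proj2 (Hz x x) eq_refl); exact e0. }
  destruct Hy as [y [By nky]].
  destruct (proj1 (Htop _) (open_Complement_closure (F n)) y nky) as [r [r0 Hr]].
  assert (Hn : 0 < / INR (S n)) by (apply Rinv_0_lt_compat, lt_0_INR; lia).
  (* Below [r] the new ball avoids [F n]; the two halves make the inclusion
     into the old ball and the bound on the radius strict. *)
  set (e' := Rmin r (Rmin ((e - dist x y) / 2) (/ INR (S n) / 2))).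
  assert (He' : 0 < e' /\ e' <= r /\ e' <= (e - dist x y) / 2 /\ e' <= / INR (S n) / 2).
  { unfold e'; repeat split; [repeat apply Rmin_pos; lra | apply Rmin_l | |].
    - eapply Rle_trans; [apply Rmin_r | apply Rmin_l].
    - eapply Rle_trans; [apply Rmin_r | apply Rmin_r]. }
  destruct He' as [e'0 [er [ed en]]].
  assert (sub : forall z, dist y z < e' -> dist x z < e).
  { intros z Hz'; specialize (tri x y z); lra. }
  unshelve eexists; [refine (Build_avoiding_ball _ _ _ _ (S n) y e' e'0 _ _)|].
  - intros z Hz'; exact (bU z (sub z Hz')).
  - intros j z Hj Hz' Fz.
    destruct (Nat.eq_dec j n) as [->|nj].
    + apply (Hr z); [lra | exact (subset_closure _ _ Fz)].
    + apply (bF j z); [lia | exact (sub z Hz') | exact Fz].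
  - unfold refines; simpl depth; simpl radius; simpl center.
    repeat split; lra.
Qed.

Lemma inv_INR_S_small (e : R) :
  0 < e -> exists N, forall n, (N <= n)%nat -> / INR (S n) < e.
Proof.
  intros e0; destruct (archimed_cor1 e e0) as [N [HN N0]].
  exists N; intros n Hn; eapply Rle_lt_trans; [|exact HN].
  apply Rinv_le_contravar; [apply lt_0_INR; exact N0 | apply le_INR; lia].
Qed.

(** If [U] were the union of the nowhere dense [F j], dependent choice along
    [refines] would yield nested balls in [U] with radii tending to 0; by
    completeness their centers converge to a point of [U] outside all [F j]. *)
Lemma completely_metrizable_Baire (dc : DC) (X : TopologicalSpace) :
  completely_metrizable X -> Baire_space X.
Proof.
  intros [dist [Hm [Hc Htop]]] U oU [x0 Ux0] [F [HF HU]].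
  pose proof Hm as [Hp [Hz [Hs tri]]].
  destruct (dc (avoiding_ball dist U F) refines) as [u Hu].
  { destruct (proj1 (Htop U) oU x0 Ux0) as [e [e0 He]].
    constructor; refine (Build_avoiding_ball _ _ _ _ 0%nat x0 e e0 He _).
    intros j y Hj; lia. }
  { intros b; apply refinement_exists; assumption. }
  (* The depth may start above 0, so it is only bounded below by the index. *)
  assert (Hd : forall k, (k <= depth (u k))%nat).
  { induction k as [|k IH]; [lia|]; destruct (Hu k) as [-> _]; lia. }
  assert (nest : forall j k, dist (center (u k)) (center (u (j + k)%nat))
                             + radius (u (j + k)%nat) <= radius (u k)).
  { induction j as [|j IH]; intros k.
    - simpl; rewrite (proj2 (Hz _ _) eq_refl); lra.
    - destruct (Hu (j + k)%nat) as [_ [_ H]]; simpl.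
      specialize (IH k).
      pose proof (tri (center (u k)) (center (u (j + k)%nat))
                    (center (u (S (j + k))))); lra. }
  assert (small : forall e, 0 < e -> exists N, forall n, (N <= n)%nat -> radius (u n) < e).
  { intros e e0; destruct (inv_INR_S_small e e0) as [N HN].
    exists (S N); intros [|n] Hn; [lia|].
    destruct (Hu n) as [_ [H _]]; eapply Rlt_trans; [exact H|].
    apply HN; specialize (Hd n); lia. }
  destruct (Hc (fun n => center (u n))) as [l Hl].
  { intros e e0; destruct (small (e / 2)) as [N HN]; [lra|].
    exists N; intros m n Hm' Hn.
    pose proof (nest (m - N)%nat N) as H1; pose proof (nest (n - N)%nat N) as H2.
    rewrite !Nat.sub_add in H1, H2 by assumption.
    pose proof (radius_pos _ _ _ (u m)); pose proof (radius_pos _ _ _ (u n)).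
    specialize (HN N (le_n N)).
    pose proof (tri (center (u m)) (center (u N)) (center (u n))) as T.
    rewrite (Hs (center (u m)) (center (u N))) in T; lra. }
  assert (lball : forall k, dist (center (u k)) l < radius (u k)).
  { intros k; destruct (Hu k) as [_ [_ H]].
    enough (dist (center (u (S k))) l <= radius (u (S k))).
    { pose proof (tri (center (u k)) (center (u (S k))) l); lra. }
    apply le_epsilon; intros e e0; destruct (Hl e e0) as [N HN].
    specialize (HN (N + S k)%nat ltac:(lia)); simpl in HN.
    pose proof (nest N (S k)) as H1.
    pose proof (radius_pos _ _ _ (u (N + S k)%nat)).
    pose proof (tri (center (u (S k))) (center (u (N + S k)%nat)) l); lra. }
  destruct (proj1 (HU l)) as [j Fj].
  { exact (ball_in _ _ _ (u 0%nat) l (lball 0%nat)). }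
  apply (ball_avoids _ _ _ (u (S j)) j l); [|apply lball | exact Fj].
  specialize (Hd (S j)); lia.
Qed.

(** * The eighteen operators *)

(** [U] meets [A] inside the union of its intersection with [B] and the
    difference of [A] and [B]. *)
Lemma second_category_points_mod_meager {X : TopologicalSpace} (A B : Ensemble X) :
  meager (symmetric_difference A B) ->
  second_category_points A = second_category_points B.
Proof.
  assert (half : forall A B : Ensemble X, meager (symmetric_difference A B) ->
    forall p, second_category_points A p -> second_category_points B p).
  { clear; intros A B HAB p dp U oU Up mB; apply (dp U oU Up).
    apply (meager_subset _ _ (meager_Union _ _ mB HAB)).
    intros x [y Uy Ay]; destruct (classic (B y)) as [By|nBy].
    - left; split; assumption.
    - right; left; split; assumption. }
  intros HAB; apply set_ext; intros p; split; apply half; [exact HAB|].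
  apply (meager_subset _ _ HAB); intros x [y Hy|y Hy]; [right | left]; exact Hy.
Qed.

Lemma second_category_points_open {X : TopologicalSpace} (U : Ensemble X) :
  Baire_space X -> is_open U -> second_category_points U = closure U.
Proof.
  intros HX oU; apply set_ext; intros p; split.
  - intros dp V oV Vp; apply NNPP; intros none; apply (dp V oV Vp).
    apply meager_of_empty; intros x Hx; apply none; exists x; exact Hx.
  - intros kp V oV Vp; apply HX; [apply open_intersection; assumption|].
    exact (kp V oV Vp).
Qed.

(** A closed set differs from its interior by its meager boundary, and [d] is
    the closure on the interior. *)
Lemma second_category_points_closure {X : TopologicalSpace} (Y : Ensemble X) :
  Baire_space X ->
  second_category_points (closure Y) =
  closure (Complement (closure (Complement (closure Y)))).
Proof.
  intros HX.
  rewrite (second_category_points_mod_meager _ _ (meager_boundary Y)).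
  apply second_category_points_open; [exact HX | apply open_Complement_closure].
Qed.

(** [Y] is the complement of an open set [U] equal to [A] up to a meager set.
    Writing the two values as words in [k] and [c] applied to [Y] makes every
    identity about [d A] a consequence of those about [k] and [c] alone, for
    instance [d (c A) = k (c (d A))]. *)
Lemma Baire_property_second_category_points {X : TopologicalSpace} (A : Ensemble X) :
  Baire_space X -> Baire_property A ->
  exists Y, second_category_points A = closure (Complement (closure Y)) /\
    second_category_points (Complement A) =
    closure (Complement (closure (Complement (closure Y)))).
Proof.
  intros HX [U [oU HAU]]; exists (Complement U).
  rewrite (closure_Complement_open U oU), Complement_Complement; split.
  - rewrite (second_category_points_mod_meager _ _ HAU).
    apply second_category_points_open; assumption.
  - rewrite (second_category_points_mod_meager (Complement A) (Complement U)).
    (* The complement of [U] is closed, so [d] is the closure of its interior. *)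
    + rewrite <- (closure_Complement_open U oU) at 1.
      rewrite second_category_points_closure by exact HX.
      rewrite (closure_Complement_open U oU), Complement_Complement; reflexivity.
    + apply (meager_subset _ _ HAU); intros x [y [nA nnU]|y [nU nnA]].
      * right; split; [apply NNPP; exact nnU | exact nA].
      * left; split; [apply NNPP; exact nnA | exact nU].
Qed.

Definition eighteen (X : TopologicalSpace) : list (set_operator X) :=
  let k := @closure X in
  let c := @Complement X in
  let d := @second_category_points X in
  [ (fun A => A);
    (fun A => k A);
    (fun A => c (k A));
    (fun A => k (c (k A)));
    (fun A => c (k (c (k A))));
    (fun A => k (c (k (c (k A)))));
    (fun A => c (k (c (k (c (k A))))));
    (fun A => c A);
    (fun A => k (c A));
    (fun A => c (k (c A)));
    (fun A => k (c (k (c A))));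
    (fun A => c (k (c (k (c A)))));
    (fun A => k (c (k (c (k (c A))))));
    (fun A => c (k (c (k (c (k (c A)))))));
    (fun A => d A);
    (fun A => c (d A));
    (fun A => k (c (d A)));
    (fun A => c (k (c (d A)))) ].

Lemma eighteen_KD (X : TopologicalSpace) :
  forall o, List.In o (eighteen X) -> KD X o.
Proof.
  apply Forall_forall; unfold eighteen; repeat constructor;
    repeat first [ exact (KD_one X) | exact (KD_k X) | exact (KD_c X) | exact (KD_d X)
                 | apply (KD_mul X closure) | apply (KD_mul X Complement)].
Qed.

(** Stability of [eighteen] under left multiplication passes from two factors to
    their product, so only [k], [c] and [d] need to be multiplied with the
    eighteen words; the identities, read from left to right as rewriting rules,
    bring each product to the normal form of some entry.  The operator [w']
    must not depend on [A], since operators and not their values are counted. *)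
Lemma KD_mul_eighteen (X : TopologicalSpace) (HX : Baire_space X)
    (o w : set_operator X) :
  KD X o -> List.In w (eighteen X) ->
  exists w', List.In w' (eighteen X) /\
    forall A, Baire_property A -> o (w A) = w' A.
Proof.
  intros Ho; revert w; induction Ho as [| | | |o1 o2 _ IH1 _ IH2]; intros w Hw.
  { exists w; split; [exact Hw | reflexivity]. }
  4: { destruct (IH2 w Hw) as [w2 [Hw2 E2]], (IH1 w2 Hw2) as [w1 [Hw1 E1]].
       exists w1; split; [exact Hw1|]; intros A HA.
       rewrite (E2 A HA); exact (E1 A HA). }
  (* For each of the 54 products the entries are tried in order. *)
  all: apply Exists_exists; revert w Hw; apply Forall_forall; unfold eighteen;
    repeat apply Forall_cons; try apply Forall_nil;
    repeat first
      [ apply Exists_cons_hd; intros A HA;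
        destruct (Baire_property_second_category_points A HX HA) as [Y [dA dcA]];
        repeat first
          [ rewrite dA | rewrite dcA
          | rewrite Complement_Complement
          | rewrite closure_closure
          | rewrite Kuratowski_identity
          | rewrite second_category_points_closure by exact HX
          | rewrite (second_category_points_open (Complement (closure _)) HX
                       (open_Complement_closure _)) ];
        reflexivity
      | apply Exists_cons_tl ].
Qed.

Lemma KD_eighteen (X : TopologicalSpace) (HX : Baire_space X) (o : set_operator X) :
  KD X o ->
  exists w, List.In w (eighteen X) /\ forall A, Baire_property A -> o A = w A.
Proof.
  intros Ho; exact (KD_mul_eighteen X HX o (fun A => A) Ho (or_introl eq_refl)).
Qed.

(** * The topology of the line *)

Lemma open_R (U : Ensemble R_top) :
  is_open U <-> forall x, U x -> exists e, 0 < e /\ forall y, Rabs (x - y) < e -> U y.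
Proof.
  split; intros oU x Ux.
  - destruct (oU x Ux) as [e He]; exists (pos e); split; [apply cond_pos|].
    intros y Hy; apply He; unfold disc; rewrite Rabs_minus_sym; exact Hy.
  - destruct (oU x Ux) as [e [e0 He]]; exists (mkposreal e e0).
    intros y Hy; apply He; rewrite Rabs_minus_sym; exact Hy.
Qed.

Lemma completely_metrizable_R : completely_metrizable R_top.
Proof.
  exists Rdist; repeat split.
  - intros x y; apply Rge_le, Rdist_pos.
  - apply Rdist_refl.
  - apply Rdist_refl.
  - apply Rdist_sym.
  - intros x y z; apply Rdist_tri.
  - intros u Hu; destruct (R_complete u) as [l Hl].
    + intros e e0; destruct (Hu e e0) as [N HN]; exists N.
      intros n m Hn Hm; apply HN; assumption.
    + exists l; intros e e0; destruct (Hl e e0) as [N HN]; exists N; exact HN.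
  - apply open_R.
  - apply open_R.
Qed.

Lemma open_interval (a b : R) : @is_open R_top (fun x => a < x < b).
Proof.
  apply open_R; intros x Hx; exists (Rmin (x - a) (b - x)); split;
    [apply Rmin_pos; lra|].
  intros y Hy; apply Rabs_def2 in Hy.
  pose proof (Rmin_l (x - a) (b - x)); pose proof (Rmin_r (x - a) (b - x)); lra.
Qed.

Definition rational : Ensemble R_top := fun x => exists n z, x = IZR z / INR (S n).

Definition dense_in_line (D : R -> Prop) : Prop :=
  forall a b, a < b -> exists x, a < x < b /\ D x.

Lemma grid_gap (n : nat) (x : R) :
  exists z, IZR z / INR (S n) <= x < (IZR z + 1) / INR (S n).
Proof.
  assert (H : 0 < INR (S n)) by (apply lt_0_INR; lia).
  exists (up (x * INR (S n)) - 1)%Z; rewrite minus_IZR.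
  destruct (archimed (x * INR (S n))) as [H1 H2].
  split; [apply Rmult_le_reg_r with (INR (S n)) | apply Rmult_lt_reg_r with (INR (S n))];
    try exact H; unfold Rdiv; rewrite Rmult_assoc, Rinv_l; lra.
Qed.

Lemma rational_dense : dense_in_line rational.
Proof.
  intros a b ab; destruct (inv_INR_S_small (b - a)) as [n Hn]; [lra|].
  specialize (Hn n (le_n n)); destruct (grid_gap n a) as [z [H1 H2]].
  assert (H : (IZR z + 1) / INR (S n) = IZR z / INR (S n) + / INR (S n))
    by (unfold Rdiv; ring).
  exists ((IZR z + 1) / INR (S n)); split; [lra|].
  exists n, (z + 1)%Z; rewrite plus_IZR; reflexivity.
Qed.

(** The fractions with denominator [n + 1] form a closed grid of isolated points,
    so the rationals are a countable union of nowhere dense grids. *)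
Lemma meager_rational : meager rational.
Proof.
  exists (fun n x => exists z, x = IZR z / INR (S n)); split; [|reflexivity].
  intros n U oU Uk [x Ux].
  assert (H : 0 < INR (S n)) by (apply lt_0_INR; lia).
  destruct (grid_gap n x) as [z Hz].
  destruct (proj1 (open_R U) oU x Ux) as [e [e0 He]].
  set (r := (IZR z + 1) / INR (S n)) in *.
  (* A point of [U] slightly to the right of [x] falls strictly between two
     consecutive points of the grid. *)
  assert (Hy : exists y, x < y < r /\ y < x + e).
  { exists (x + Rmin ((r - x) / 2) (e / 2)).
    pose proof (Rmin_l ((r - x) / 2) (e / 2)); pose proof (Rmin_r ((r - x) / 2) (e / 2)).
    assert (0 < Rmin ((r - x) / 2) (e / 2)) by (apply Rmin_pos; lra); lra. }
  destruct Hy as [y [Hy Hye]].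
  apply (open_disjoint_closure (fun w : R_top => IZR z / INR (S n) < w < r)
           (fun w => exists z, w = IZR z / INR (S n)) (open_interval _ _)) with y.
  - intros w [H1 H2] [z' ->]; unfold r in H2.
    apply Rmult_lt_reg_r in H1, H2; try (apply Rinv_0_lt_compat; exact H).
    rewrite <- plus_IZR in H2; apply lt_IZR in H1, H2; lia.
  - lra.
  - apply Uk, He; apply Rabs_def1; lra.
Qed.

(** Otherwise an open interval would consist of rationals and be meager. *)
Lemma irrational_dense (HR : Baire_space R_top) :
  dense_in_line (fun x => ~ rational x).
Proof.
  intros a b ab; apply NNPP; intros none.
  apply (HR _ (open_interval a b)).
  - exists ((a + b) / 2); red; lra.
  - apply (meager_subset _ _ meager_rational); intros x Hx.
    apply NNPP; intros nx; apply none; exists x; split; assumption.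
Qed.

Lemma real_dense : dense_in_line (fun _ => True).
Proof. intros a b ab; exists ((a + b) / 2); split; [lra | exact I]. Qed.

(** The dense set [D] stands for the line, the rationals or the irrationals, the
    three ways in which a set may fill an interval next to [p]. *)
Lemma closure_right (D : R -> Prop) (S : Ensemble R_top) (p b : R) :
  dense_in_line D -> p < b -> (forall x, p < x < b -> D x -> S x) -> closure S p.
Proof.
  intros HD pb HS U oU Up; destruct (proj1 (open_R U) oU p Up) as [e [e0 He]].
  destruct (HD p (Rmin b (p + e))) as [x [Hx Dx]]; [apply Rmin_glb_lt; lra|].
  pose proof (Rmin_l b (p + e)); pose proof (Rmin_r b (p + e)).
  exists x; split; [apply He, Rabs_def1; lra | apply HS; [lra | exact Dx]].
Qed.

Lemma closure_left (D : R -> Prop) (S : Ensemble R_top) (a p : R) :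
  dense_in_line D -> a < p -> (forall x, a < x < p -> D x -> S x) -> closure S p.
Proof.
  intros HD pb HS U oU Up; destruct (proj1 (open_R U) oU p Up) as [e [e0 He]].
  destruct (HD (Rmax a (p - e)) p) as [x [Hx Dx]]; [apply Rmax_lub_lt; lra|].
  pose proof (Rmax_l a (p - e)); pose proof (Rmax_r a (p - e)).
  exists x; split; [apply He, Rabs_def1; lra | apply HS; [lra | exact Dx]].
Qed.

Lemma not_closure (S : Ensemble R_top) (a b p : R) :
  a < p < b -> (forall x, a < x < b -> ~ S x) -> ~ closure S p.
Proof. intros Hp HS; exact (open_disjoint_closure _ _ (open_interval a b) HS p Hp). Qed.

(** * A subset of the line with eighteen distinct images *)

(** Each piece separates some words: the isolated point 1 is lost in [k c k c k A],
    the missing point 3 is filled in [c k c k c k c A], the rationals below 0 are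
    seen by [k] but not by [d], and the irrationals above 4 are seen by [d] but
    have no interior.  The gap around 1/2 stays outside every image under a word with
    an even number of complements and so tells these from the other images. *)
Definition example : Ensemble R_top := fun x =>
  (x < 0 /\ rational x) \/ x = 1 \/ 2 < x < 3 \/ 3 < x < 4 \/ (4 < x /\ ~ rational x).

Ltac sets := unfold Complement, Ensembles.In, example in *; intuition lra.

Lemma closure_example (HR : Baire_space R_top) :
  closure example = fun x => x <= 0 \/ x = 1 \/ 2 <= x.
Proof.
  apply set_ext; intros p; split.
  - intros kp; apply NNPP; intros Hp; revert kp.
    destruct (Rlt_dec p 1);
      [apply (not_closure _ 0 1) | apply (not_closure _ 1 2)]; try sets; intros x Hx; sets.
  - intros [Hp|[->|Hp]].
    + apply (closure_left rational _ (p - 1) p rational_dense); [lra|]; intros x Hx; sets.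
    + apply subset_closure; sets.
    + destruct (Rlt_dec p 3).
      * apply (closure_right _ _ p 3 real_dense); [lra|]; intros x Hx; sets.
      * destruct (Rlt_dec p 4).
        -- apply (closure_right _ _ p 4 real_dense); [lra|]; intros x Hx; sets.
        -- apply (closure_right _ _ p (p + 1) (irrational_dense HR)); [lra|];
             intros x Hx; sets.
Qed.

Lemma closure_Complement_example (HR : Baire_space R_top) :
  closure (Complement example) = fun x => x <= 2 \/ x = 3 \/ 4 <= x.
Proof.
  apply set_ext; intros p; split.
  - intros kp; apply NNPP; intros Hp; revert kp.
    destruct (Rlt_dec p 3);
      [apply (not_closure _ 2 3) | apply (not_closure _ 3 4)]; try sets; intros x Hx; sets.
  - intros [Hp|[->|Hp]].
    + destruct (Rle_dec p 0).
      * apply (closure_left _ _ (p - 1) p (irrational_dense HR)); [lra|];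
          intros x Hx; sets.
      * destruct (Rle_dec p 1).
        -- apply (closure_left _ _ 0 p real_dense); [lra|]; intros x Hx; sets.
        -- apply (closure_left _ _ 1 p real_dense); [lra|]; intros x Hx; sets.
    + apply subset_closure; sets.
    + apply (closure_right rational _ p (p + 1) rational_dense); [lra|]; intros x Hx; sets.
Qed.

Lemma closure_two_intervals (a b c : R) (S : Ensemble R_top) :
  a < b < c -> (forall x, S x <-> a < x < b \/ b < x < c) ->
  closure S = fun x => a <= x <= c.
Proof.
  intros Habc HS; apply set_ext; intros p; split.
  - intros kp; apply NNPP; intros Hp; revert kp; destruct (Rlt_dec p a);
      [apply (not_closure _ (p - 1) a) | apply (not_closure _ c (p + 1))]; try lra;
      intros x Hx Sx; apply HS in Sx; lra.
  - intros Hp; destruct (Rlt_dec p b).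
    + apply (closure_right _ _ p b real_dense); [lra|]; intros x Hx _; apply HS; lra.
    + destruct (Rlt_dec p c).
      * apply (closure_right _ _ p c real_dense); [lra|]; intros x Hx _; apply HS; lra.
      * apply (closure_left _ _ b p real_dense); [lra|]; intros x Hx _; apply HS; lra.
Qed.

Lemma closure_two_rays (a b : R) (S : Ensemble R_top) :
  a < b -> (forall x, S x <-> x < a \/ b < x) ->
  closure S = fun x => x <= a \/ b <= x.
Proof.
  intros Hab HS; apply set_ext; intros p; split.
  - intros kp; apply NNPP; intros Hp; revert kp.
    apply (not_closure _ a b); [lra|]; intros x Hx Sx; apply HS in Sx; lra.
  - intros [Hp|Hp].
    + apply (closure_left _ _ (p - 1) p real_dense); [lra|]; intros x Hx _; apply HS; lra.
    + apply (closure_right _ _ p (p + 1) real_dense); [lra|]; intros x Hx _; apply HS; lra.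
Qed.

Lemma closure_right_ray (a : R) (S : Ensemble R_top) :
  (forall x, S x <-> a < x) -> closure S = fun x => a <= x.
Proof.
  intros HS; apply set_ext; intros p; split.
  - intros kp; apply NNPP; intros Hp; revert kp.
    apply (not_closure _ (p - 1) a); [lra|]; intros x Hx Sx; apply HS in Sx; lra.
  - intros Hp; apply (closure_right _ _ p (p + 1) real_dense); [lra|];
      intros x Hx _; apply HS; lra.
Qed.

Lemma closure_left_ray (a : R) (S : Ensemble R_top) :
  (forall x, S x <-> x < a) -> closure S = fun x => x <= a.
Proof.
  intros HS; apply set_ext; intros p; split.
  - intros kp; apply NNPP; intros Hp; revert kp.
    apply (not_closure _ a (p + 1)); [lra|]; intros x Hx Sx; apply HS in Sx; lra.
  - intros Hp; apply (closure_left _ _ (p - 1) p real_dense); [lra|];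
      intros x Hx _; apply HS; lra.
Qed.

Lemma rational_IZR (z : Z) : rational (IZR z).
Proof. exists 0%nat, z; simpl; field. Qed.

(** The points 1, 3 and 4, where the two sets may also differ, are rational. *)
Lemma example_mod_meager :
  meager (symmetric_difference example (fun x => 2 < x)).
Proof.
  apply (meager_subset _ _ meager_rational).
  intros x [y [Ay nUy]|y [Uy nAy]]; unfold Ensembles.In, example in *.
  - destruct Ay as [[_ Hy]|[->|?]]; [exact Hy | apply rational_IZR | lra].
  - destruct (Req_dec y 3) as [->|]; [apply rational_IZR|].
    destruct (Req_dec y 4) as [->|]; [apply rational_IZR|].
    apply NNPP; intros nr; apply nAy.
    destruct (Rlt_dec y 3), (Rlt_dec y 4); intuition lra.
Qed.

Lemma open_right_ray (a : R) : @is_open R_top (fun x => a < x).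
Proof.
  apply open_R; intros x Hx; exists (x - a); split; [lra|].
  intros y Hy; apply Rabs_def2 in Hy; lra.
Qed.

Lemma second_category_points_example (HR : Baire_space R_top) :
  second_category_points example = fun x => 2 <= x.
Proof.
  rewrite (second_category_points_mod_meager _ _ example_mod_meager).
  rewrite second_category_points_open by (exact HR || apply open_right_ray).
  apply closure_right_ray; reflexivity.
Qed.

Definition test_points : list R := [-1; 3; 1; 2; 5; 1/2].

Definition membership (S : Ensemble R) (v : list bool) : Prop :=
  Forall2 (fun p b => S p <-> b = true) test_points v.

(** The rows follow the order of [eighteen]. *)
Definition membership_table : list (list bool) :=
  let y := true in
  let n := false in
  [ [y; n; y; n; n; n];
    [y; y; y; y; y; n];
    [n; n; n; n; n; y];
    [n; n; y; y; n; y];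
    [y; y; n; n; y; n];
    [y; y; n; y; y; n];
    [n; n; y; n; n; y];
    [n; y; n; y; y; y];
    [y; y; y; y; y; y];
    [n; n; n; n; n; n];
    [n; y; n; y; n; n];
    [y; n; y; n; y; y];
    [y; n; y; y; y; y];
    [n; y; n; n; n; n];
    [n; y; n; y; y; n];
    [y; n; y; n; n; y];
    [y; n; y; y; n; y];
    [n; y; n; n; y; n] ].

Lemma membership_table_NoDup : NoDup membership_table.
Proof. repeat constructor; simpl; intuition discriminate. Qed.

Lemma membership_eighteen_example (HR : Baire_space R_top) :
  Forall2 membership (map (fun o => o example) (eighteen R_top)) membership_table.
Proof.
  assert (kA := closure_example HR).
  assert (kckA : closure (Complement (closure example)) =
                 fun x => 0 <= x <= 2).
  { rewrite kA; apply closure_two_intervals with 1; [lra|]; intros x; split; intros Hx.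
    - assert (~ x <= 0 /\ x <> 1 /\ ~ 2 <= x) by sets.
      destruct (Rlt_dec x 1); lra.
    - sets. }
  assert (kckckA : closure (Complement (closure (Complement (closure example)))) =
                   fun x => x <= 0 \/ 2 <= x).
  { rewrite kckA; apply closure_two_rays; [lra|]; intros x; split; intros Hx; [|sets].
    destruct (Rlt_dec x 0); [left; assumption | right; apply Rnot_le_lt; sets]. }
  assert (kcA := closure_Complement_example HR).
  assert (kckcA : closure (Complement (closure (Complement example))) =
                  fun x => 2 <= x <= 4).
  { rewrite kcA; apply closure_two_intervals with 3; [lra|]; intros x; split; intros Hx.
    - assert (~ x <= 2 /\ x <> 3 /\ ~ 4 <= x) by sets.
      destruct (Rlt_dec x 3); lra.
    - sets. }
  assert (kckckcA : closure (Complement (closure (Complement (closure (Complement example))))) =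
                    fun x => x <= 2 \/ 4 <= x).
  { rewrite kckcA; apply closure_two_rays; [lra|]; intros x; split; intros Hx; [|sets].
    destruct (Rlt_dec x 2); [left; assumption | right; apply Rnot_le_lt; sets]. }
  assert (dA := second_category_points_example HR).
  assert (kcdA : closure (Complement (second_category_points example)) = fun x => x <= 2).
  { rewrite dA; apply closure_left_ray; intros x; split; [apply Rnot_le_lt | sets]. }
  unfold eighteen, membership_table, membership, test_points; cbn [map].
  rewrite kckckA, kckA, kA, kckckcA, kckcA, kcA, kcdA, dA.
  pose proof (rational_IZR (-1)); pose proof (rational_IZR 5).
  repeat apply Forall2_cons; try apply Forall2_nil;
    unfold Complement, Ensembles.In, example;
    (split; [intros Hp; try reflexivity; exfalso | intros e; try discriminate e]);
    first [intuition lra | apply Hp; left; split; [lra | assumption]].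
Qed.

Theorem theorem2 (dc : DC) :
  (PB ->
     (forall X : TopologicalSpace, Polish X -> card_le (KD X) 18) /\
     (exists A : Ensemble R_top, cardinal (Im (KD R_top) (fun o => o A)) 18))
  /\
  ((forall X : TopologicalSpace, Polish X ->
      card_le (Im (KD X) restrict_BP) 18) /\
   (exists A : Ensemble R_top, Baire_property A /\
      cardinal (Im (KD R_top) (fun o => o A)) 18)).
Proof.
  assert (HR : Baire_space R_top)
    by exact (completely_metrizable_Baire dc R_top completely_metrizable_R).
  assert (BPA : Baire_property example).
  { exists (fun x => 2 < x); split; [apply open_right_ray | apply example_mod_meager]. }
  assert (card : cardinal (Im (KD R_top) (fun o => o example)) 18).
  { replace (Im (KD R_top) (fun o => o example)) with
      (fun S => List.In S (map (fun o => o example) (eighteen R_top))).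
    - apply (cardinal_of_NoDup (map (fun o => o example) (eighteen R_top))).
      apply (NoDup_of_Forall2 membership _ membership_table).
      + intros S v v'; apply Forall2_truth_values.
      + apply membership_eighteen_example; exact HR.
      + apply membership_table_NoDup.
    - apply set_ext; intros S; split.
      + intros HS; apply in_map_iff in HS; destruct HS as [o [<- Ho]].
        exists o; [apply eighteen_KD; exact Ho | reflexivity].
      + intros [o Ho B ->]; destruct (KD_eighteen R_top HR o Ho) as [w [Hw E]].
        rewrite (E example BPA); exact (in_map (fun o => o example) _ w Hw). }
  split; [intros pb|]; split; try (exists example; auto); intros X HX;
    pose proof (completely_metrizable_Baire dc X (proj2 HX)) as BX.
  - apply (card_le_of_list (eighteen X)); intros o Ho.
    destruct (KD_eighteen X BX o Ho) as [w [Hw E]].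
    replace o with w; [exact Hw|]; apply functional_extensionality; intros A.
    symmetry; apply E, pb, HX.
  - apply (card_le_of_list (map restrict_BP (eighteen X))); intros f [o Ho g ->].
    destruct (KD_eighteen X BX o Ho) as [w [Hw E]].
    apply in_map_iff; exists w; split; [|exact Hw].
    apply functional_extensionality; intros [A HA]; symmetry; exact (E A HA).
Qed.
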